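(* Let $d\ge 0$ and $l\ge 1$ be integers, let $\alpha_1,\dots,\alpha_d\in\mathbb{C}$, $\rho\in\mathbb{C}\setminus\{0\}$, and let $R(H)=\rho\prod_{j=1}^{d}(H+\alpha_j+1)$, where $H=x\partial_x$. Let $G=R(H)\partial_x$, $\eta=l^{d+1}\rho$, and for $n\ge0$ let $P_n(x)=e^{G^l}x^n$. Let $i\in\{0,\dots,l-1\}$ and assume that none of the numbers $S_{k,r}(i)$, $(k,r)\in I_i$, is a non-positive integer. Then for every $m\ge 0$, with $n=ml+i$, $$P_n(x)=\eta^{ml}\,x^i\prod_{(k,r)\in I_i}\bigl(S_{k,r}(i)\bigr)_m\;{}_1F_{ld+l-1}\left[\begin{matrix}-m\\ \hat S(i)\end{matrix};-\left(\frac{x}{\eta}\right)^{l}\right].$$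
   Context: $H=x\partial_x$ and $G=R(H)\partial_x$ act as differential operators on $\mathbb{C}[x]$, and $e^{G^l}x^n=\sum_{j\ge0}\frac{G^{lj}x^n}{j!}$ (a finite sum). Put $\alpha_{d+1}=0$ and, for $i\in\{0,\dots,l-1\}$, $1\le k\le d+1$, $0\le r\le l-1$, put $S_{k,r}(i)=\frac{\alpha_k+i-r}{l}+1$. Note $S_{d+1,i}(i)=1$. Let $I_i$ be the set of all pairs $(k,r)$ with $1\le k\le d+1$, $0\le r\le l-1$, except $(k,r)=(d+1,i)$, and let $\hat S(i)$ be the list (with multiplicity) of the $ld+l-1$ numbers $S_{k,r}(i)$, $(k,r)\in I_i$. Pochhammer symbol: $(a)_0=1$, $(a)_j=a(a+1)\cdots(a+j-1)$. Generalized hypergeometric series: ${}_pF_q\left[\begin{matrix}a_1,\dots,a_p\\ b_1,\dots,b_q\end{matrix};z\right]=\sum_{j\ge0}\frac{(a_1)_j\cdots(a_p)_j}{(b_1)_j\cdots(b_q)_j}\frac{z^j}{j!}$. *)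

(* Defs.v *)
From mathcomp Require Import all_boot all_order all_algebra.
From mathcomp Require Import complex.
From mathcomp Require Import boolp classical_sets functions cardinality fsbigop.
From mathcomp Require Import reals topology normedtype sequences.

Set Implicit Arguments.
Unset Strict Implicit.
Unset Printing Implicit Defensive.

Import Order.TTheory GRing.Theory Num.Theory.
Import numFieldNormedType.Exports.
Local Open Scope ring_scope.

Definition euler_op (K : fieldType) (f : {poly K}) : {poly K} := 'X * f^`().

(* q(T), the polynomial q evaluated at the operator T. *)
Definition poly_of_op (K : fieldType) (q : {poly K})
    (T : {poly K} -> {poly K}) (f : {poly K}) : {poly K} :=
  \sum_(i < size q) q`_i *: iter i T f.

Definition Rpoly (K : fieldType) (d : nat) (alpha : 'I_d -> K) (rho : K) :
    {poly K} :=
  rho *: \prod_(j < d) ('X + (alpha j + 1)%:P).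

Definition G_op (K : fieldType) (d : nat) (alpha : 'I_d -> K) (rho : K)
    (f : {poly K}) : {poly K} :=
  poly_of_op (Rpoly alpha rho) (@euler_op K) f^`().

(* e^T f = sum_(j >= 0) T^j f / j!, meaningful when only finitely many terms
   are nonzero: the library's finitely supported sum is 0 otherwise. *)
Definition exp_op (K : fieldType) (T : {poly K} -> {poly K})
    (f : {poly K}) : {poly K} :=
  \sum_(j \in [set: nat]) (j`!%:R^-1 *: iter j T f).

Definition P_poly (K : fieldType) (d l : nat) (alpha : 'I_d -> K) (rho : K)
    (n : nat) : {poly K} :=
  exp_op (iter l (G_op alpha rho)) 'X^n.

Definition pochhammer (K : fieldType) (a : K) (j : nat) : K :=
  \prod_(t < j) (a + t%:R).

(* The sum of the series, as the limit of its partial sums in K; this is the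
   usual pFq when the series converges and no entry of b is a non-positive
   integer. *)
Definition hypergeometric (K : numFieldType) (a b : seq K) (z : K) : K :=
  limn (series (fun j : nat =>
    (\prod_(c <- a) pochhammer c j) / (\prod_(c <- b) pochhammer c j)
      * (z ^+ j / j`!%:R))).

(* The index k in 1..d+1 is shifted to 0..d, so that alpha_{d+1} = 0 sits at
   the index ord_max. *)
Definition alpha_ext (K : fieldType) (d : nat) (alpha : 'I_d -> K)
    (k : 'I_d.+1) : K :=
  if unlift ord_max k is Some j then alpha j else 0.

Definition S_param (K : fieldType) (d l : nat) (alpha : 'I_d -> K) (i : 'I_l)
    (kr : 'I_d.+1 * 'I_l) : K :=
  (alpha_ext alpha kr.1 + i%:R - kr.2%:R) / l%:R + 1.

Definition I_set (d l : nat) (i : 'I_l) : {set 'I_d.+1 * 'I_l} :=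
  [set~ (ord_max, i)].

Definition S_hat (K : fieldType) (d l : nat) (alpha : 'I_d -> K) (i : 'I_l) :
    seq K :=
  [seq S_param alpha i kr | kr in I_set d i].

(* Main.v *)
Require Import Defs.
From mathcomp Require Import all_boot all_order all_algebra.
From mathcomp Require Import complex.
From mathcomp Require Import classical_sets fsbigop.
From mathcomp Require Import reals topology normedtype sequences.
From mathcomp Require Import ring.

Set Implicit Arguments.
Unset Strict Implicit.

Import Order.TTheory GRing.Theory Num.Theory.
Import numFieldNormedType.Exports.
Local Open Scope ring_scope.
Local Open Scope complex_scope.

(** The monomials are eigenvectors of H, so G^l multiplies x^n by an explicit
    scalar and lowers the degree by l:
      G^l x^n = rho^l prod_(k, r) (n - r + alpha_k) x^(n - l).
    On the residue class n = m l + i each factor is l (S_(k,r)(i) + m - 1), so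
    the scalar is the quotient A_m / A_(m-1) of consecutive values of
      A_m = eta^(m l) prod_(k, r) (S_(k,r)(i))_m
    ([chain_scalarS]); the pair (d+1, i) contributes the factor m to it, so that
    G^l x^i = 0.  As rho <> 0 and no S_(k,r)(i) is a non-positive integer, A_m
    never vanishes, hence u_m = x^(m l + i) / A_m is defined, and G^l acts as the
    pure shift u_m -> u_(m-1), u_0 -> 0.  Hence the exponential is a truncated
    exponential series
      e^(G^l) u_m = sum_(s <= m) u_s / (m - s)!
    ([exp_op_shift]).  The right-hand side is a finite sum too, because
    (-m)_s = (-1)^s m! / (m - s)! for s <= m and 0 beyond
    ([hypergeometric_terminating]), and the two sums agree term by term. *)

(** * Powers of the lowering operator on monomials *)

Lemma poly_of_op_eulerXn (K : fieldType) (q : {poly K}) (c : K) (n : nat) :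
  poly_of_op q (@euler_op K) (c *: 'X^n) = (c * q.[n%:R]) *: 'X^n.
Proof.
have iterE j : iter j (@euler_op K) (c *: 'X^n) = (c * n%:R ^+ j) *: 'X^n.
  elim: j => [|j IHj]; first by rewrite expr0 mulr1.
  rewrite iterS IHj /euler_op derivZ derivXn -scalerAr.
  case: n {IHj} => [|n].
    by rewrite mulr0n mulr0 scaler0 exprS mul0r mulr0 scale0r.
  by rewrite mulrnAr -exprS -scaler_nat scalerA -mulrA -exprSr.
rewrite /poly_of_op horner_coef mulr_sumr scaler_suml.
by apply: eq_bigr => j _; rewrite iterE scalerA mulrCA.
Qed.

(** The scalar n R(n-1) such that G x^n = n R(n-1) x^(n-1), at n = a.  The
    factor n coming from the derivative is absorbed into the product as the one
    with alpha_(d+1) = 0, so that all d+1 factors have the same shape. *)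
Definition G_scalar (K : fieldType) (d : nat) (alpha : 'I_d -> K) (rho a : K) :
    K :=
  rho * \prod_(k < d.+1) (a + alpha_ext alpha k).

Lemma G_scalarE (K : fieldType) (d : nat) (alpha : 'I_d -> K) (rho a : K) :
  G_scalar alpha rho a = a * (rho * \prod_(j < d) (a + alpha j)).
Proof.
rewrite /G_scalar big_ord_recr /= /alpha_ext unlift_none addr0.
rewrite mulrA mulrC; congr (_ * (_ * _)).
apply: eq_bigr => j _; congr (_ + _).
have -> : widen_ord (leqnSn d) j = lift ord_max j.
  by apply: val_inj; rewrite /= /bump leqNgt ltn_ord.
by rewrite liftK.
Qed.

Lemma G_opXn (K : fieldType) (d : nat) (alpha : 'I_d -> K) (rho c : K)
    (n : nat) :
  G_op alpha rho (c *: 'X^n) = (c * G_scalar alpha rho n%:R) *: 'X^(n.-1).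
Proof.
rewrite /G_op derivZ derivXn -scaler_nat scalerA poly_of_op_eulerXn.
rewrite G_scalarE -!mulrA.
case: n => [|n]; first by rewrite !mul0r.
congr ((_ * (_ * _)) *: _).
rewrite /Rpoly hornerZ horner_prod; congr (_ * _).
by apply: eq_bigr => j _; rewrite !hornerE /= -natr1; ring.
Qed.

(** Although n - r is truncated, the formula holds for every r: once r exceeds
    n, the factor t = n of the product is zero. *)
Lemma iter_G_opXn (K : fieldType) (d : nat) (alpha : 'I_d -> K) (rho c : K)
    (n r : nat) :
  iter r (G_op alpha rho) (c *: 'X^n)
    = (c * \prod_(t < r) G_scalar alpha rho (n%:R - t%:R)) *: 'X^(n - r).
Proof.
elim: r => [|r IHr]; first by rewrite big_ord0 mulr1 subn0.
rewrite iterS IHr G_opXn big_ord_recr /= mulrA subnS.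
have [le_rn|lt_nr] := leqP r n; first by rewrite natrB.
rewrite (bigD1 (Ordinal lt_nr)) //= subrr G_scalarE !mul0r.
by rewrite !(mulr0, mul0r) !scale0r.
Qed.

(** * The scalars along a residue class of exponents modulo l *)

Lemma pochhammerS (K : fieldType) (a : K) (j : nat) :
  pochhammer a j.+1 = pochhammer a j * (a + j%:R).
Proof. by rewrite /pochhammer big_ord_recr. Qed.

Lemma pochhammer1 (K : fieldType) (j : nat) :
  pochhammer (1 : K) j = j`!%:R.
Proof.
elim: j => [|j IHj]; first by rewrite /pochhammer big_ord0.
by rewrite pochhammerS IHj nat1r -natrM factS mulnC.
Qed.

Lemma pochhammer_neq0 (K : fieldType) (a : K) (j : nat) :
  (forall s : nat, a != - s%:R) -> pochhammer a j != 0.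
Proof. by move=> a_neq; apply/prodf_neq0 => t _; rewrite addr_eq0. Qed.

(** The product of the scalars by which G^l multiplies the monomials of degrees
    i + l, ..., i + m l. *)
Definition chain_scalar (K : fieldType) (d l : nat) (alpha : 'I_d -> K)
    (rho : K) (i : 'I_l) (m : nat) : K :=
  (l%:R ^+ d.+1 * rho) ^+ (m * l)
    * \prod_(kr : 'I_d.+1 * 'I_l) pochhammer (S_param alpha i kr) m.

(** The excluded pair (d+1, i) has parameter 1, and (1)_m = m!. *)
Lemma chain_scalarE (K : fieldType) (d l : nat) (alpha : 'I_d -> K)
    (rho : K) (i : 'I_l) (m : nat) :
  chain_scalar alpha rho i m
    = (l%:R ^+ d.+1 * rho) ^+ (m * l) * m`!%:R
      * \prod_(kr in I_set d i) pochhammer (S_param alpha i kr) m.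
Proof.
rewrite /chain_scalar (bigD1 (ord_max, i)) //= mulrA.
congr (_ * _ * _); last by apply: eq_bigl => kr; rewrite !inE.
rewrite /S_param /alpha_ext /= unlift_none add0r subrr mul0r add0r.
exact: pochhammer1.
Qed.

Lemma chain_scalar_neq0 (K : numFieldType) (d l : nat) (alpha : 'I_d -> K)
    (rho : K) (i : 'I_l) (m : nat) :
  rho != 0 ->
  (forall kr : 'I_d.+1 * 'I_l, kr \in I_set d i ->
     forall s : nat, S_param alpha i kr != - s%:R) ->
  chain_scalar alpha rho i m != 0.
Proof.
move=> rho_neq0 S_neq; rewrite chain_scalarE !mulf_neq0 //.
- rewrite expf_neq0 // mulf_neq0 // expf_neq0 // pnatr_eq0 -lt0n.
  exact: leq_ltn_trans (ltn_ord i).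
- by rewrite pnatr_eq0 -lt0n fact_gt0.
- by apply/prodf_neq0 => kr /S_neq; apply: pochhammer_neq0.
Qed.

(** Pulling l out of each factor,
      (m+1) l + i - r + alpha_k = l (S_(k,r)(i) + m),
    turns the scalar of G^l into the last factors of the Pochhammer symbols. *)
Lemma chain_scalarS (K : numFieldType) (d l : nat) (alpha : 'I_d -> K)
    (rho : K) (i : 'I_l) (m : nat) :
  chain_scalar alpha rho i m.+1
    = chain_scalar alpha rho i m
      * \prod_(r < l) G_scalar alpha rho ((m.+1 * l + i)%:R - r%:R).
Proof.
have l_neq0 : l%:R != 0 :> K.
  by rewrite pnatr_eq0 -lt0n; apply: leq_ltn_trans (ltn_ord i).
have factorE (r : 'I_l) : G_scalar alpha rho ((m.+1 * l + i)%:R - r%:R)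
    = (l%:R ^+ d.+1 * rho) * \prod_(k < d.+1) (S_param alpha i (k, r) + m%:R).
  have -> : l%:R ^+ d.+1 = \prod_(k < d.+1) l%:R :> K.
    by rewrite prodr_const card_ord.
  rewrite /G_scalar mulrAC -big_split /= mulrC; congr (_ * _).
  apply: eq_bigr => k _; rewrite /S_param /= natrD natrM -natr1.
  by field.
rewrite (eq_bigr _ (fun r _ => factorE r)) big_split /= prodr_const card_ord.
rewrite exchange_big pair_big /= /chain_scalar mulSn exprD.
under [in LHS]eq_bigr do rewrite pochhammerS.
under [X in _ = _ * (_ * X)]eq_bigr do rewrite -surjective_pairing.
rewrite big_split /=.
by ring.
Qed.

(** * Exponential of a shift *)

(** T^j u_m is u_(m-j) for j <= m and 0 beyond.  The scalars a in the hypotheses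
    replace the linearity of T. *)
Lemma exp_op_shift (K : fieldType) (T : {poly K} -> {poly K})
    (u : nat -> {poly K}) (c : K) (m : nat) :
  (forall a, T (a *: u 0%N) = 0) ->
  (forall a s, T (a *: u s.+1) = a *: u s) ->
  exp_op T (c *: u m) = c *: \sum_(s < m.+1) ((m - s)`!%:R^-1 *: u s).
Proof.
move=> Tu0 TuS.
have T0 : T 0 = 0 by rewrite -[X in T X](scale0r (u 0%N)) Tu0.
have iter0 j : iter j T 0 = 0 by elim: j => //= j ->.
have iter_le j s : iter j T (c *: u (s + j)%N) = c *: u s.
  by elim: j => [|j IHj]; rewrite ?addn0 // addnS iterSr TuS IHj.
have iter_gt j : (m < j)%N -> iter j T (c *: u m) = 0.
  move=> lt_mj; rewrite -(subnK lt_mj) iterD iterS.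
  by rewrite (iter_le m 0%N) Tu0 iter0.
rewrite /exp_op -(fsbig_widen (`I_m.+1)%classic); first last.
- by move=> j [_ /= /negP]; rewrite -leqNgt => /iter_gt ->; rewrite scaler0.
- by [].
(* The summation index becomes s = m - j. *)
rewrite -fsbig_ord /= scaler_sumr (reindex_inj rev_ord_inj) /=.
apply: eq_bigr => s _; rewrite subSS scalerA mulrC -scalerA; congr (_ *: _).
by rewrite -[RHS](iter_le (m - s)%N) subnKC ?leq_ord.
Qed.

(** * The terminating hypergeometric series *)

Lemma pochhammerN (K : fieldType) (m s : nat) :
  pochhammer (- m%:R : K) s = (-1) ^+ s * (m ^_ s)%:R.
Proof.
elim: s => [|s IHs]; first by rewrite /pochhammer big_ord0 mul1r.
rewrite pochhammerS IHs ffactnSr natrM exprS.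
have [le_sm|lt_ms] := leqP s m; first by rewrite natrB //; ring.
by rewrite ffact_small // !(mulr0, mul0r).
Qed.

(** The partial sums are constant from rank m+1 on, so their limit is a finite
    sum; the signs of (-m)_s are absorbed into the argument - z. *)
Lemma hypergeometric_terminating (K : numFieldType) (m : nat) (b : seq K)
    (z : K) :
  hypergeometric [:: - m%:R] b z
    = \sum_(s < m.+1) m`!%:R / (m - s)`!%:R / (\prod_(c <- b) pochhammer c s)
        * ((- z) ^+ s / s`!%:R).
Proof.
rewrite /hypergeometric; set t := (fun j : nat => _ * _).
have t_gt j : (m < j)%N -> t j = 0.
  by move=> lt_mj; rewrite /t big_seq1 pochhammerN ffact_small // mulr0 !mul0r.
have sumE : limn (series t) = \sum_(s < m.+1) t s.
  apply: lim_near_cst; first exact: norm_hausdorff.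
  exists m.+1 => // n /= le_mn.
  rewrite seriesEord /= (big_ord_widen n t le_mn) [RHS]big_mkcond /=.
  apply: eq_bigr => s _; case: ltnP => // lt_ms; exact: t_gt.
rewrite sumE; apply: eq_bigr => s _.
rewrite /t big_seq1 pochhammerN (exprNn z) -(ffact_fact (leq_ord s)) natrM.
rewrite mulfK.
  by ring.
by rewrite pnatr_eq0 -lt0n fact_gt0.
Qed.

(** * The hypergeometric formula *)

Theorem theorem3p5 (R : realType) (d l : nat) (hl : (1 <= l)%N)
    (alpha : 'I_d -> R[i]) (rho : R[i]) (hrho : rho != 0) (i : 'I_l)
    (hS : forall kr : 'I_d.+1 * 'I_l, kr \in I_set d i ->
            forall s : nat, S_param alpha i kr != - s%:R)
    (m : nat) (x : R[i]) :
  let eta : R[i] := l%:R ^+ d.+1 * rho in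
  (P_poly l alpha rho (m * l + i)).[x] =
    eta ^+ (m * l) * x ^+ i
      * (\prod_(kr in I_set d i) pochhammer (S_param alpha i kr) m)
      * hypergeometric [:: - m%:R] (S_hat alpha i) (- (x / eta) ^+ l).
Proof.
move=> eta.
pose A := chain_scalar alpha rho i.
have A_neq0 s : A s != 0 by apply: chain_scalar_neq0.
pose u s : {poly R[i]} := (A s)^-1 *: 'X^(s * l + i).
have Gu0 a : iter l (G_op alpha rho) (a *: u 0%N) = 0.
  (* The factor r = i of the scalar vanishes. *)
  rewrite /u scalerA iter_G_opXn mul0n add0n (bigD1 i) //= subrr G_scalarE.
  by rewrite !mul0r mulr0 scale0r.
have GuS a s : iter l (G_op alpha rho) (a *: u s.+1) = a *: u s.
  rewrite /u !scalerA iter_G_opXn mulSn -addnA addKn; congr (_ *: _).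
  have := A_neq0 s.+1; rewrite /A chain_scalarS mulSn -addnA => As1_neq0.
  have := As1_neq0; rewrite mulf_eq0 negb_or => /andP[As_neq0 step_neq0].
  by field; rewrite As_neq0.
have -> : P_poly l alpha rho (m * l + i)
    = A m *: \sum_(s < m.+1) ((m - s)`!%:R^-1 *: u s).
  by rewrite -(exp_op_shift _ _ Gu0 GuS) /u scalerA divff // scale1r.
rewrite hypergeometric_terminating hornerZ horner_sum !mulr_sumr.
apply: eq_bigr => s _.
rewrite !hornerZ hornerXn opprK /S_hat big_image /= /A !chain_scalarE -/eta.
have := A_neq0 s; rewrite /A chain_scalarE -/eta !mulf_eq0 !negb_or.
move=> /andP[/andP[eta_neq0 fs_neq0] B_neq0].
have fms_neq0 : (m - s)`!%:R != 0 :> R[i] by rewrite pnatr_eq0 -lt0n fact_gt0.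
rewrite -exprM (mulnC l) expr_div_n exprD.
by field; rewrite eta_neq0 fs_neq0 B_neq0.
Qed.
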